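(* Let $k$ be a finite field of order $q$ and let $n\ge1$. Then $\dim_k\bigl(k[x]_0/W_n\bigr)=\binom{q^n}{2}$. In particular, $W_n$ is a proper $T$-space of $k[x]_0$.
   Context: $k[x]_0$ denotes the free associative $k$-algebra without unit on one generator $x$ (polynomials in $x$ over $k$ with zero constant term). A $T$-space of $k[x]_0$ is a $k$-linear subspace invariant under all $k$-algebra endomorphisms of $k[x]_0$. $W_n$ is the smallest $T$-space of $k[x]_0$ containing $x+x^{q^n}$ and $x^{q^n+1}$. *)

(* Defs.v *)
From HB Require Import structures.
From mathcomp Require Import all_boot all_order all_algebra boolp.

Set Implicit Arguments.
Unset Strict Implicit.
Unset Printing Implicit Defensive.

Import GRing.Theory.
Local Open Scope ring_scope.

Section FreeNonunital.
Variable k : fieldType.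

Definition zero_cst : {pred {poly k}} := fun p => p`_0 == 0.

Fact zero_cst_submod : submod_closed zero_cst.
Proof.
split; first by rewrite unfold_in coef0.
move=> a p r; rewrite !unfold_in coefD coefZ => /eqP-> /eqP->.
by rewrite mulr0 addr0.
Qed.
HB.instance Definition _ := GRing.isSubmodClosed.Build k {poly k} zero_cst
  zero_cst_submod.

(* k[x]_0, the free k-algebra without unit on one generator *)
Record poly0 := Poly0 { poly0_val : {poly k}; _ : poly0_val \in zero_cst }.
HB.instance Definition _ := [isSub for poly0_val].
HB.instance Definition _ := [Choice of poly0 by <:].
HB.instance Definition _ := [SubChoice_isSubLmodule of poly0 by <:].

Fact poly0_mul_subproof (f g : poly0) : val f * val g \in zero_cst.
Proof. by rewrite unfold_in coef0M (eqP (valP f)) mul0r. Qed.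
(* The library's rings have a unit, so the product of k[x]_0 is kept apart
   from its canonical k-module structure. *)
Definition poly0_mul (f g : poly0) : poly0 := Poly0 (poly0_mul_subproof f g).

Definition alg_endo (phi : poly0 -> poly0) : Prop :=
  linear phi /\ {morph phi : f g / poly0_mul f g >-> poly0_mul f g}.

(* Boolean predicates lose no generality: classically every subset is one. *)
Definition tspace (S : {pred poly0}) : Prop :=
  submod_closed S /\
  forall phi : poly0 -> poly0, alg_endo phi -> {in S, forall f, phi f \in S}.

Definition proper_tspace (S : {pred poly0}) : Prop :=
  tspace S /\ exists f : poly0, f \notin S.

Definition tspace_gen (G : seq poly0) : {pred poly0} :=
  fun f => `[< forall S : {pred poly0}, tspace S -> {subset G <= S} -> f \in S >].

Lemma mem_tspace_gen (G : seq poly0) : {subset G <= tspace_gen G}.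
Proof. by move=> f Gf; apply/asboolP => S _; apply. Qed.

Lemma tspace_gen_min (G : seq poly0) (S : {pred poly0}) :
  tspace S -> {subset G <= S} -> {subset tspace_gen G <= S}.
Proof. by move=> tS sGS f /asboolP; apply. Qed.

Lemma tspace_genP (G : seq poly0) : tspace (tspace_gen G).
Proof.
split; first split.
- by apply/asboolP => S [[]].
- move=> a f g /asboolP fS /asboolP gS; apply/asboolP => S tS sGS.
  by case: (tS) => [[_ linS] _]; apply: linS; [apply: fS | apply: gS].
- move=> phi ephi f /asboolP fS; apply/asboolP => S tS sGS.
  by case: (tS) => _ endoS; apply: endoS => //; apply: fS.
Qed.

HB.instance Definition _ (G : seq poly0) :=
  GRing.isSubmodClosed.Build k poly0 (tspace_gen G)
    (tspace_genP G).1.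

End FreeNonunital.

Section QuotientModule.
Variables (R : pzRingType) (V : lmodType R) (W : submodClosed V).

Fact submod_zmod_closed : zmod_closed W.
Proof. exact: GRing.subsemimod_closedB (GRing.subsemimodClosedP W). Qed.

Definition submod_zmod : zmodClosed V :=
  HB.pack (GRing.SubmodClosed.sort W) (GRing.isZmodClosed.Build V _ submod_zmod_closed).

(* The library quotient by an additive subgroup carries no scaling; it is
   induced from V below. *)
Definition quotmod := Quotient.quot submod_zmod.
HB.instance Definition _ := GRing.Zmodule.on quotmod.

Definition quotmod_pi (v : V) : quotmod := \pi_(Quotient.quot submod_zmod)%qT v.

Lemma quotmod_eq (u v : V) : (quotmod_pi u == quotmod_pi v) = (u - v \in W).
Proof. by rewrite -Quotient.idealrBE. Qed.

Lemma quotmod_piK (u : quotmod) : quotmod_pi (repr u) = u.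
Proof. exact: reprK. Qed.

Lemma quotmod_piD (u v : V) : quotmod_pi (u + v) = quotmod_pi u + quotmod_pi v.
Proof. exact: Quotient.pi_add. Qed.

Definition quotmod_scale (a : R) (u : quotmod) : quotmod :=
  quotmod_pi (a *: repr u).

Lemma quotmod_piZ (a : R) (v : V) :
  quotmod_pi (a *: v) = quotmod_scale a (quotmod_pi v).
Proof.
apply/eqP; rewrite quotmod_eq -scalerBr.
apply: GRing.subsemimod_closedZ (GRing.subsemimodClosedP W) _ _ _.
by rewrite -quotmod_eq quotmod_piK.
Qed.

Fact quotmod_scalerA a b v :
  quotmod_scale a (quotmod_scale b v) = quotmod_scale (a * b) v.
Proof. by rewrite -[v]quotmod_piK -!quotmod_piZ scalerA. Qed.

Fact quotmod_scale1r : left_id 1 quotmod_scale.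
Proof. by move=> v; rewrite -[v]quotmod_piK -quotmod_piZ scale1r. Qed.

Fact quotmod_scalerDr : right_distributive quotmod_scale +%R.
Proof.
move=> a u v; rewrite -[u]quotmod_piK -[v]quotmod_piK.
by rewrite -quotmod_piD -!quotmod_piZ -quotmod_piD scalerDr.
Qed.

Fact quotmod_scalerDl v : {morph quotmod_scale^~ v : a b / a + b}.
Proof.
move=> a b; rewrite -[v]quotmod_piK -!quotmod_piZ -quotmod_piD.
by rewrite scalerDl.
Qed.

HB.instance Definition _ := GRing.Zmodule_isLmodule.Build R quotmod
  quotmod_scalerA quotmod_scale1r quotmod_scalerDr quotmod_scalerDl.

End QuotientModule.

(* V has a linear isomorphism to 'rV_d; in particular V is finite-dimensional. *)
Definition has_dim (F : fieldType) (V : lmodType F) (d : nat) : Prop :=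
  inhabited (Vector.axiom d V).

Section Wn.
Variables (k : finFieldType) (n : nat).

Fact wgen_add_subproof : 'X + 'X^(#|k| ^ n) \in @zero_cst k.
Proof.
have q_gt0 : (0 < #|k| ^ n)%N.
  by rewrite expn_gt0; apply/orP; left; apply/card_gt0P; exists 0.
by rewrite unfold_in coefD coefX coefXn add0r (ltn_eqF q_gt0).
Qed.
Definition wgen_add : poly0 k := Poly0 wgen_add_subproof.

Fact wgen_pow_subproof : 'X^((#|k| ^ n).+1) \in @zero_cst k.
Proof. by rewrite unfold_in coefXn. Qed.
Definition wgen_pow : poly0 k := Poly0 wgen_pow_subproof.

Definition Wn : submodClosed (poly0 k) := tspace_gen [:: wgen_add; wgen_pow].

End Wn.

(* Main.v *)
(* Write [Q = q^n], [t = X + X^Q] and [s = X^(Q+1)]. Raising to the power [Q] is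
   the substitution [X |-> X^Q] on [k[X]], so for every [u] both [u + u^Q] and
   [u u^Q] are symmetric polynomials evaluated at [(X, X^Q)]; hence W_n lies in
   the subalgebra [k[t, s]]. As [s] is integral over [k[t]] of degree [Q], this
   subalgebra is the sum of the [k[t] s^a] with [a < Q], whose degrees are
   distinct modulo [Q]; so the degrees of its elements lie in the numerical
   semigroup generated by [Q] and [Q + 1], and W_n realizes all positive ones.
   The quotient thus has the monomials [X^m] as a basis, where [m] runs over
   the [Q (Q - 1) / 2] gaps of that semigroup. *)

Require Import Defs.
From mathcomp Require Import all_boot all_order all_algebra all_field.
From mathcomp Require Import boolp zify ring.

Set Implicit Arguments.
Unset Strict Implicit.
Unset Printing Implicit Defensive.

Import GRing.Theory.
Local Open Scope ring_scope.

(** * Gaps of the numerical semigroup generated by [Q] and [Q + 1] *)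

Definition gap (Q m : nat) := (m %/ Q < m %% Q)%N.

(** In base [Q], [b * Q + a * (Q + 1)] has remainder [a] and quotient [b + a], which is at least
    [a]. The bound [a < Q] costs nothing, as [Q] copies of [Q + 1] equal [Q + 1] copies of [Q]. *)
Lemma gapPn (Q m : nat) : (0 < Q)%N ->
  reflect (exists a b, (a < Q)%N /\ m = (b * Q + a * Q.+1)%N) (~~ gap Q m).
Proof.
move=> Q0; apply: (iffP idP) => [|[a [b [aQ ->]]]]; rewrite /gap -leqNgt.
  move=> le_am; exists (m %% Q)%N, (m %/ Q - m %% Q)%N.
  by rewrite ltn_mod mulnS addnCA addnC -mulnDl subnK // -divn_eq.
have -> : (b * Q + a * Q.+1 = (b + a) * Q + a)%N by lia.
by rewrite modnMDl modn_small // divnMDl // divn_small // addn0 leq_addl.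
Qed.

Definition gaps (Q : nat) : seq nat :=
  [seq (b * Q + a)%N | b <- iota 0 Q, a <- iota b.+1 (Q - b.+1)].

Lemma size_gaps (Q : nat) : size (gaps Q) = 'C(Q, 2).
Proof.
rewrite size_allpairs_dep sumnE big_map -[X in iota 0 X]subn0 -/(index_iota 0 Q).
rewrite -bin2_sum [RHS]big_nat_rev /= add0n.
by apply: eq_bigr => i _; rewrite size_iota.
Qed.

Lemma mem_gaps (Q m : nat) : (0 < Q)%N -> (m \in gaps Q) = gap Q m.
Proof.
move=> Q0; apply/allpairsPdep/idP => [[b [a []]]|].
  rewrite !mem_iota add0n => bQ /andP[ba aQ] ->.
  have ltaQ : (a < Q)%N by lia.
  by rewrite /gap modnMDl divnMDl // modn_small // divn_small // addn0.
rewrite /gap => lt_ba; exists (m %/ Q)%N, (m %% Q)%N.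
rewrite !mem_iota -divn_eq add0n lt_ba subnKC ?ltn_pmod //=.
  by rewrite (ltn_trans lt_ba) ?ltn_pmod.
by rewrite (leq_trans lt_ba) // ltnW ?ltn_pmod.
Qed.

Lemma uniq_gaps (Q : nat) : uniq (gaps Q).
Proof.
apply: allpairs_uniq_dep => [|b _|x y]; rewrite ?iota_uniq //.
move=> /allpairsPdep[b [a [+ + ->]]] /allpairsPdep[b' [a' [+ + ->]]] /=.
rewrite !mem_iota => bQ /andP[ba aQ] b'Q /andP[ba' aQ'] eqba.
have Q0 : (0 < Q)%N by lia.
have ltaQ : (a < Q)%N by lia.
have lta'Q : (a' < Q)%N by lia.
have := congr1 (modn^~ Q) eqba; have := congr1 (divn^~ Q) eqba.
rewrite /= !modnMDl !divnMDl // !divn_small // !modn_small // !addn0.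
by move=> -> ->.
Qed.

(** * The subalgebra [F[t, s]] and the degrees of its elements *)

Section SymmetricSubalgebra.
Variables (F : fieldType) (Q : nat).
Hypothesis Q_gt1 : (1 < Q)%N.

Let t : {poly F} := 'X + 'X^Q.
Let s : {poly F} := 'X^(Q.+1).

(** The outer variable stands for [s], so that a monic relation for [s] over [F[t]] can be used for
    Euclidean division. *)
Let ev (c : {poly {poly F}}) : {poly F} :=
  horner_eval s (map_poly (comp_poly t) c).

Definition symalg (p : {poly F}) := exists c, p = ev c.

Lemma symalgD p r : symalg p -> symalg r -> symalg (p + r).
Proof. by move=> [c ->] [d ->]; exists (c + d); rewrite /ev !rmorphD. Qed.

Lemma symalgM p r : symalg p -> symalg r -> symalg (p * r).
Proof. by move=> [c ->] [d ->]; exists (c * d); rewrite /ev !rmorphM. Qed.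

Lemma symalgC (a : F) : symalg a%:P.
Proof.
by exists a%:P%:P; rewrite /ev map_polyC /= comp_polyC /horner_eval hornerC.
Qed.

Lemma symalgZ a p : symalg p -> symalg (a *: p).
Proof. by rewrite -mul_polyC; apply/symalgM/symalgC. Qed.

Lemma symalg_t : symalg t.
Proof.
by exists 'X%:P; rewrite /ev map_polyC /= comp_polyX /horner_eval hornerC.
Qed.

Lemma symalg_s : symalg s.
Proof. by exists 'X; rewrite /ev map_polyX /horner_eval hornerX. Qed.

(** Newton's recurrence for the power sums of [X] and [X^Q], whose sum is [t] and whose product is
    [s]. It involves two previous terms, hence the paired induction. *)
Lemma symalg_powersum i : symalg ('X^i + 'X^(i * Q)).
Proof.
suff: symalg ('X^i + 'X^(i * Q)) /\ symalg ('X^(i.+1) + 'X^(i.+1 * Q)) by case.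
elim: i => [|i [IH0 IH1]].
  rewrite mul0n mul1n expr0 expr1 -polyCD; split; [exact: symalgC|].
  exact: symalg_t.
split=> //.
have -> : 'X^(i.+2) + 'X^(i.+2 * Q) =
    t * ('X^(i.+1) + 'X^(i.+1 * Q)) + (-1) *: (s * ('X^i + 'X^(i * Q))).
  by rewrite /t /s scaleN1r !mulSn !exprD !exprS; ring.
apply: symalgD; first exact: symalgM symalg_t _.
exact/symalgZ/symalgM/IH0/symalg_s.
Qed.

Lemma symalg_trace u : symalg (u + (u \Po 'X^Q)).
Proof.
rewrite -{1}[u]coefK comp_polyE poly_def -big_split /=.
apply: (big_ind symalg) => [||i _]; [exact: symalgC|exact: symalgD|].
by rewrite -exprM mulnC -scalerDr; apply/symalgZ/symalg_powersum.
Qed.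

(* Writing [u = v X + a], the product [u (u o X^Q)] is
   [v (v o X^Q) s + a (v X + (v X) o X^Q) + a^2]. *)
Lemma symalg_norm u : symalg (u * (u \Po 'X^Q)).
Proof.
elim/poly_ind: u => [|v a IHv]; first by rewrite mul0r; apply: symalgC.
have -> : (v * 'X + a%:P) * ((v * 'X + a%:P) \Po 'X^Q) =
    (v * (v \Po 'X^Q)) * s + (a *: (v * 'X + ((v * 'X) \Po 'X^Q)) + (a * a)%:P).
  rewrite comp_polyD !comp_polyM comp_polyX comp_polyC -mul_polyC polyCM.
  by rewrite /s exprS; ring.
apply: symalgD; first exact/symalgM/symalg_s.
by apply: symalgD; [apply/symalgZ/symalg_trace | apply: symalgC].
Qed.

(** Since [X^Q = t - X], a power [X^m] with [m >= Q] is [t X^(m-Q) - X^(m-Q+1)], and both exponents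
    are below [m] because [Q > 1]. *)
Lemma X_expansion m :
  exists c : 'I_Q -> {poly F}, 'X^m = \sum_j (c j \Po t) * 'X^j.
Proof.
have [N] := ubnP m; elim: N m => // N IH m; rewrite ltnS => le_mN.
have [mQ|Qm] := ltnP m Q.
  exists (fun j => (j == Ordinal mQ)%:R).
  rewrite (bigD1 (Ordinal mQ)) //= eqxx comp_polyC mul1r big1 ?addr0 //.
  by move=> j /negPf->; rewrite comp_poly0 mul0r.
have [c cE] := IH (m - Q)%N ltac:(lia).
have [d dE] := IH (m - Q).+1 ltac:(lia).
exists (fun j => 'X * c j - d j).
under eq_bigr do rewrite comp_polyB comp_polyM comp_polyX mulrBl -mulrA.
rewrite sumrB -mulr_sumr -cE -dE -{1}(subnK Qm) exprD exprS /t; ring.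
Qed.

(* Cayley-Hamilton for multiplication by [s] on [F[X]], which is free over
   [F[t]] with basis [1, X, ..., X^(Q-1)]. *)
Lemma integral_s : exists2 chi : {poly {poly F}},
  chi \is monic /\ size chi = Q.+1 & ev chi = 0.
Proof.
have /fin_all_exists[A AE] (j : 'I_Q) := X_expansion (Q.+1 + j).
pose M := \matrix_(i < Q, j < Q) A j i.
exists (char_poly M); first by rewrite char_poly_monic size_char_poly.
rewrite /ev map_char_poly /char_poly -det_map_mx; apply/eqP/det0P.
(* Column [j] of [M] expands [s X^j], so this row is killed by [s - M] once [t] and [s] are
   substituted; its entry [1] makes it nonzero. *)
exists (\row_(j < Q) 'X^j).
  apply/eqP => /rowP/(_ (Ordinal (ltnW Q_gt1))); rewrite !mxE expr0.
  exact/eqP/oner_neq0.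
apply/rowP => j; rewrite !mxE.
under eq_bigr do rewrite !mxE rmorphB rmorphMn /= /horner_eval hornerX hornerC
  mulrBr mulrC.
rewrite sumrB (bigD1 j) //= eqxx big1 ?addr0; last first.
  by move=> i /negPf->; rewrite mulr0n mul0r.
rewrite mulr1n mulrC -exprD addnC AE.
by under [X in _ - X]eq_bigr do rewrite mulrC; rewrite subrr.
Qed.

Lemma size_t : size t = Q.+1.
Proof. by rewrite /t addrC size_polyDl ?size_polyXn ?size_polyX. Qed.

Lemma size_symalg_term a (c : {poly F}) : c != 0 ->
  size ((c \Po t) * s ^+ a) = ((size c).-1 * Q + a * Q.+1).+1.
Proof.
move=> c0; have ct0 : c \Po t != 0.
  by rewrite comp_poly_eq0 ?size_t // ltnS (ltnW Q_gt1).
have := size_comp_poly c t; rewrite size_t /= => eqc.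
by rewrite /s -exprM size_mulXn // mulnC -eqc addnC -addSn prednK ?size_poly_gt0.
Qed.

(* The terms have pairwise distinct degrees, since the degree of the [a]-th
   one is [a] modulo [Q]. *)
Lemma size_symalg_sum m (c : nat -> {poly F}) : (m <= Q)%N ->
  let p := \sum_(a < m) (c a \Po t) * s ^+ a in
  p != 0 -> exists a b, (a < m)%N /\ size p = (b * Q + a * Q.+1).+1.
Proof.
elim: m => [|m IHm] lt_mQ /=; first by rewrite big_ord0 eqxx.
rewrite big_ord_recr /=; set p := \sum_(_ < _) _.
have [->|c0] := eqVneq (c m) 0.
  rewrite comp_poly0 mul0r addr0 => /(IHm (ltnW lt_mQ))[a [b [am eqp]]].
  by exists a, b; rewrite ltnS (ltnW am).
have := size_symalg_term m c0; set r := _ * _; set d := _.-1 => eqr.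
have [->|p0 _] := eqVneq p 0; first by exists m, d; rewrite add0r ltnSn.
have [a [b [am eqp]]] := IHm (ltnW lt_mQ) p0.
have [ltpr|ltrp|eqpr] := ltngtP (size p) (size r).
- by exists m, d; rewrite addrC size_polyDl.
- by exists a, b; rewrite size_polyDl // ltnS (ltnW am).
move: eqpr; rewrite eqp eqr => -[/(congr1 (modn^~ Q))].
have eqm x y : (y * Q + x * Q.+1 = (y + x) * Q + x)%N by lia.
by rewrite !eqm !modnMDl !modn_small ?(ltn_trans am) // => eqam; lia.
Qed.

(** Division by the monic relation for [s] leaves only powers [s^a] with [a < Q], and then leading
    terms cannot cancel. *)
Lemma symalg_deg p : symalg p -> p != 0 -> ~~ gap Q (size p).-1.
Proof.
move=> [c ->] p0; apply/gapPn; first exact: ltnW.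
have [chi [mchi schi] chi0] := integral_s.
pose r := Pdiv.Ring.rmodp c chi.
have evE : ev c = \sum_(a < Q) (r`_a \Po t) * s ^+ a.
  rewrite {1}(Pdiv.RingMonic.rdivp_eq mchi c) -/r.
  have -> : ev (Pdiv.Ring.rdivp c chi * chi + r) =
      ev (Pdiv.Ring.rdivp c chi) * ev chi + ev r.
    by rewrite /ev !rmorphD !rmorphM.
  rewrite chi0 mulr0 add0r /ev /horner_eval.
  rewrite (@horner_coef_wide _ Q); last first.
    rewrite (leq_trans (size_poly _ _)) // -ltnS -schi.
    by rewrite Pdiv.Ring.ltn_rmodpN0 // monic_neq0.
  by apply: eq_bigr => i _; rewrite coef_map.
move: p0; rewrite evE => /(size_symalg_sum (c := fun a => r`_a) (leqnn Q)).
by move=> [a [b [aQ ->]]]; exists a, b.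
Qed.

End SymmetricSubalgebra.

(** * The Frobenius power [u^Q] *)

Lemma pchar_nat_card_exp (k : finFieldType) n : [pchar {poly k}].-nat (#|k| ^ n)%N.
Proof.
have [p _ pchark] := finPcharP k.
rewrite (eq_pnat _ (pchar_poly k)) (eq_pnat _ (pcharf_eq pchark)).
by rewrite (card_pprimeChar pchark) -expnM pnatX pnat_id ?(pcharf_prime pchark).
Qed.

Lemma expf_card_exp (k : finFieldType) n (a : k) : a ^+ (#|k| ^ n) = a.
Proof. by elim: n => // n IHn; rewrite expnSr exprM IHn expf_card. Qed.

(** Raising to the power [q^n] is additive in characteristic [p] and fixes the coefficients, so it
    only acts on [X]. *)
Lemma poly_expf_card (k : finFieldType) n (u : {poly k}) :
  u ^+ (#|k| ^ n) = u \Po 'X^(#|k| ^ n).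
Proof.
elim/poly_ind: u => [|v a IHv].
  by rewrite comp_poly0 expr0n gtn_eqF // expn_gt0 (ltnW (finNzRing_gt1 k)).
rewrite (exprDn_pchar _ _ (pchar_nat_card_exp k n)) exprMn IHv.
by rewrite -rmorphXn /= expf_card_exp comp_polyD comp_polyM comp_polyX comp_polyC.
Qed.

(** * Endomorphisms of [k[x]_0] as substitutions *)

Section Poly0.
Variable k : fieldType.
Implicit Types (f g u : poly0 k) (phi : poly0 k -> poly0 k).

Fact comp0_subproof u f : val f \Po val u \in @zero_cst k.
Proof.
rewrite unfold_in -horner_coef0 horner_comp [(val u).[0]]horner_coef0.
by rewrite (eqP (valP u)) horner_coef0 (eqP (valP f)).
Qed.
Definition comp0 u f : poly0 k := Poly0 (comp0_subproof u f).

Lemma comp0_alg_endo u : alg_endo (comp0 u).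
Proof.
split=> [a f g|f g]; apply: val_inj.
  by rewrite /= comp_polyD comp_polyZ.
by rewrite /= comp_polyM.
Qed.

Fact monom0_subproof m : 'X^(m.+1) \in @zero_cst k.
Proof. by rewrite unfold_in coefXn. Qed.
Definition monom0 m : poly0 k := Poly0 (monom0_subproof m).

Lemma alg_endo_monom0 phi m :
  alg_endo phi -> val (phi (monom0 m)) = val (phi (monom0 0)) ^+ m.+1.
Proof.
move=> [_ phiM]; elim: m => [|m IHm]; first by rewrite expr1.
have -> : monom0 m.+1 = poly0_mul (monom0 0) (monom0 m).
  by apply: val_inj; rewrite /= -exprD.
by rewrite phiM /= IHm -exprS.
Qed.

End Poly0.

(** * Degrees of the elements of [W_n] *)

Section WnStructure.
Variables (k : finFieldType) (n : nat).
Let Q := (#|k| ^ n)%N.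
Local Notation W := (Wn k n).

Lemma card_exp_gt0 : (0 < Q)%N.
Proof. by rewrite expn_gt0 (ltnW (finNzRing_gt1 k)). Qed.

Lemma Wn_symalg f : f \in W -> symalg Q (val f).
Proof.
(* Quantifying over all endomorphisms makes [S] invariant by composition, so only the two generators
   need checking. The identity, substitution of [X], recovers the claim. *)
pose S : {pred poly0 k} := fun f =>
  `[< forall phi, alg_endo phi -> symalg Q (val (phi f)) >].
suff sWS : {subset W <= S}.
  move=> /sWS/asboolP/(_ (comp0 (monom0 k 0))) /=.
  by rewrite comp_polyXr; apply; apply: comp0_alg_endo.
move=> {f}; apply: tspace_gen_min => [|f Gf].
  split; first split.
  - apply/asboolP => phi [phiL _].
    have -> : phi 0 = 0.
      by have := phiL (-1) 0 0; rewrite !scaleN1r !addNr.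
    exact: symalgC.
  - move=> a f g /asboolP Sf /asboolP Sg; apply/asboolP => phi ephi.
    have [phiL _] := ephi; rewrite phiL.
    by apply: symalgD; [apply/symalgZ/Sf | apply: Sg].
  move=> phi [phiL phiM] f /asboolP Sf; apply/asboolP => psi [psiL psiM].
  apply: (Sf (psi \o phi)); split=> [a g h|g h] /=.
    by rewrite phiL psiL.
  by rewrite phiM psiM.
apply/asboolP => phi ephi; have phiE m := alg_endo_monom0 m ephi.
set u := val (phi _) in phiE.
have uQ : val (phi (monom0 k Q.-1)) = u ^+ Q.
  by rewrite phiE prednK // card_exp_gt0.
move: Gf; rewrite !inE => /orP[]/eqP->.
  have -> : wgen_add k n = 1 *: monom0 k 0 + monom0 k Q.-1.
    by apply: val_inj; rewrite /= scale1r prednK ?card_exp_gt0.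
  have [phiL _] := ephi; rewrite phiL scale1r /= -!/(val _) uQ -/u.
  by rewrite poly_expf_card; apply: symalg_trace.
have -> : wgen_pow k n = monom0 k Q by apply: val_inj.
by rewrite phiE exprS poly_expf_card; apply: symalg_norm.
Qed.

Lemma Wn_trace (u : poly0 k) : exists2 w : poly0 k, w \in W & val w = val u + val u ^+ Q.
Proof.
exists (comp0 u (wgen_add k n)).
  have [_] := tspace_genP [:: wgen_add k n; wgen_pow k n].
  apply; first exact: comp0_alg_endo.
  by apply: mem_tspace_gen; rewrite mem_head.
by rewrite /= comp_polyD comp_polyX comp_Xn_poly.
Qed.

Lemma Wn_norm (u : poly0 k) : exists2 w : poly0 k, w \in W & val w = val u ^+ Q.+1.
Proof.
exists (comp0 u (wgen_pow k n)).
  have [_] := tspace_genP [:: wgen_add k n; wgen_pow k n].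
  apply; first exact: comp0_alg_endo.
  by apply: mem_tspace_gen; rewrite !inE eqxx orbT.
by rewrite /= comp_Xn_poly.
Qed.

(* Polarization of the Hermitian form [u v^Q]. *)
Lemma Wn_polar (u v : poly0 k) : exists2 w : poly0 k, w \in W &
  val w = val u * val v ^+ Q + val v * val u ^+ Q.
Proof.
have [wuv Wuv wuvE] := Wn_norm (u + v).
have [wu Wu wuE] := Wn_norm u; have [wv Wv wvE] := Wn_norm v.
exists (wuv - wu - wv); first by rewrite !GRing.rpredB.
have -> : val (wuv - wu - wv) = val wuv - val wu - val wv by [].
rewrite wuvE wuE wvE (_ : val (u + v) = val u + val v) // !exprS.
by rewrite (exprDn_pchar _ _ (pchar_nat_card_exp k n)) -/Q; ring.
Qed.

Hypothesis Q_gt1 : (1 < Q)%N.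

Lemma Wn_deg f : f \in W -> f != 0 -> ~~ gap Q (size (val f)).-1.
Proof. by move=> /Wn_symalg/(symalg_deg Q_gt1). Qed.

(** For [m + 1 = b Q + a] with [a <= b], the leading monomial comes from the polar form of [X^a] and
    [X^b], which is [X^(a+bQ) + X^(b+aQ)], outside two boundary cases. *)
Lemma Wn_lead m : ~~ gap Q m.+1 -> exists2 w : poly0 k, w \in W &
  exists2 r : {poly k}, (size r <= m.+1)%N & val w = 'X^(m.+1) + r.
Proof.
rewrite /gap -leqNgt; set a := (_ %% _)%N; set b := (_ %/ _)%N => le_ab.
have mE : m.+1 = (b * Q + a)%N by exact: divn_eq.
clearbody a b.
have szX (i : nat) : (i <= m)%N -> (size ('X^i : {poly k}) <= m.+1)%N.
  by rewrite size_polyXn.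
(* Here the polar form would give [2 X^(a+aQ)], zero in characteristic 2; the norm of [X^b] replaces
   it. *)
have [eqab|lt_ab] := eqVneq a b.
  have [w Ww wE] := Wn_norm (monom0 k b.-1); exists w => //.
  exists 0; first by rewrite size_poly0.
  rewrite wE addr0 mE eqab -exprM prednK; last by lia.
  by rewrite mulnS addnC.
have {le_ab}lt_ab : (a < b)%N by rewrite ltn_neqAle lt_ab.
(* The difference of the two sides is [(b - a)(Q - 1)]. *)
have lt_aQb : (b + a * Q < b * Q + a)%N by nia.
(* [X^0] is not in [k[x]_0], so [a = 0] uses the trace of [X^b]. *)
have [a0|a_gt0] := posnP a.
  have [w Ww wE] := Wn_trace (monom0 k b.-1); exists w => //.
  exists 'X^b; first by apply: szX; rewrite -ltnS mE; lia.
  by rewrite wE addrC mE a0 addn0 /= -exprM prednK // -a0.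
have [w Ww wE] := Wn_polar (monom0 k a.-1) (monom0 k b.-1); exists w => //.
exists 'X^(b + a * Q); first by apply: szX; rewrite -ltnS mE.
by rewrite wE /= -!exprM !prednK ?(leq_ltn_trans _ lt_ab) // -!exprD mE addnC.
Qed.

(** * Gap monomials as a basis of the quotient *)

Let d := 'C(Q, 2).
Let g (i : 'I_d) := nth 0%N (gaps Q) i.

Let g_inj : injective g.
Proof.
move=> i j /eqP; rewrite nth_uniq ?uniq_gaps ?size_gaps //.
by move=> /eqP/val_inj.
Qed.

Let gap_g i : gap Q (g i).
Proof. by rewrite -mem_gaps ?card_exp_gt0 // mem_nth ?size_gaps. Qed.

Let g_surj m : gap Q m -> exists i, g i = m.
Proof.
rewrite -mem_gaps ?card_exp_gt0 // => /(nthP 0%N)[i]; rewrite size_gaps => id.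
by exists (Ordinal id).
Qed.

Let g_gt0 i : (0 < g i)%N.
Proof. by have := gap_g i; rewrite /gap; case: (g i) => //; rewrite mod0n. Qed.

Let lift0 (c : 'rV[k]_d) : poly0 k := \sum_i c 0 i *: monom0 k (g i).-1.

Let lift0_linear : linear lift0.
Proof.
move=> a x y; rewrite /lift0 scaler_sumr -big_split /=.
by apply: eq_bigr => i _; rewrite !mxE scalerDl scalerA.
Qed.

Let val_lift0 c : val (lift0 c) = \sum_i c 0 i *: 'X^(g i).
Proof.
rewrite /lift0 raddf_sum; apply: eq_bigr => i _.
by rewrite /= prednK.
Qed.

Let lift0_delta i : val (lift0 (delta_mx 0 i)) = 'X^(g i).
Proof.
rewrite val_lift0 (bigD1 i) //= mxE !eqxx scale1r big1 ?addr0 // => j /negPf ji.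
by rewrite mxE ji andbF scale0r.
Qed.

(** A nonzero combination of gap monomials has a gap as its degree, which no nonzero element of
    [W_n] has. *)
Let lift0_Wn_inj c : lift0 c \in W -> c = 0.
Proof.
move=> Wc; have [c0|nzc] := eqVneq (lift0 c) 0.
  apply/rowP => i; rewrite mxE; have : (val (lift0 c))`_(g i) = 0.
    by rewrite c0 coef0.
  rewrite val_lift0 coef_sum (bigD1 i) //= coefZ coefXn eqxx.
  rewrite mulr1 big1 ?addr0 // => j ji; rewrite coefZ coefXn.
  by rewrite (inj_eq g_inj) eq_sym (negPf ji) mulr0.
have /negP[] := Wn_deg Wc nzc; set m := (size _).-1.
have : (val (lift0 c))`_m != 0 by rewrite -/(lead_coef _) lead_coef_eq0.
have [[i <-]|nogi /eqP[]] := pselect (exists i, g i = m); first by rewrite gap_g.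
rewrite val_lift0 coef_sum big1 // => i _.
rewrite coefZ coefXn; case: eqP => [mi|]; last by rewrite mulr0.
by case: nogi; exists i.
Qed.

(** Reduction by leading terms: each positive degree is that of a gap monomial or of a monic element
    of [W_n], and subtracting a multiple of it lowers the degree. *)
Let lift0_Wn_surj f : exists c, f - lift0 c \in W.
Proof.
have lift0Z a c : lift0 (a *: c) = a *: lift0 c.
  by rewrite /lift0 scaler_sumr; apply: eq_bigr => i _; rewrite mxE scalerA.
have lift00 : lift0 0 = 0 by rewrite -(scale0r (0 : 'rV_d)) lift0Z scale0r.
have [N] := ubnP (size (val f)); elim: N f => // N IHN f; rewrite ltnS => szf.
have [->|nzf] := eqVneq f 0.
  by exists 0; rewrite lift00 subrr GRing.rpred0.
have nzvf : val f != 0 by [].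
case szE: (size (val f)).-1 => [|m].
  (* In degree 0 the leading coefficient is the constant term, which vanishes. *)
  case/negP: nzvf; rewrite -lead_coef_eq0 /lead_coef szE; exact: (valP f).
have {}szE : size (val f) = m.+2 by lia.
suff [h [c Wh] [r szr hE]] : exists2 h : poly0 k, exists c, h - lift0 c \in W &
    exists2 r : {poly k}, (size r <= m.+1)%N & val h = 'X^(m.+1) + r.
  have [|c' Wc'] := IHN (f - lead_coef (val f) *: h).
    rewrite (leq_trans _ szf) // szE ltnS; apply/leq_sizeP => j.
    rewrite (_ : val _ = val f - lead_coef (val f) *: val h) // hE.
    rewrite coefB coefZ coefD coefXn.
    rewrite leq_eqVlt => /predU1P[<-|ltmj].
      by rewrite (nth_default _ szr) addr0 eqxx mulr1 /lead_coef szE subrr.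
    rewrite (nth_default _ (leq_trans szr (ltnW ltmj))) addr0 gtn_eqF //.
    by rewrite nth_default ?szE // mulr0 subr0.
  exists (lead_coef (val f) *: c + c'); rewrite lift0_linear.
  have -> : f - (lead_coef (val f) *: lift0 c + lift0 c') =
      (f - lead_coef (val f) *: h - lift0 c') + lead_coef (val f) *: (h - lift0 c).
    by rewrite scalerBr opprD [RHS]addrACA subrK; congr (_ + _); rewrite addrC.
  by rewrite GRing.rpredD // GRing.rpredZ.
have [/g_surj[i gi]|/Wn_lead[w Ww wE]] := boolP (gap Q m.+1); last first.
  by exists w => //; exists 0; rewrite lift00 subr0.
exists (lift0 (delta_mx 0 i)).
  by exists (delta_mx 0 i); rewrite subrr GRing.rpred0.
by exists 0; rewrite ?size_poly0 // lift0_delta gi addr0.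
Qed.

Lemma has_dim_Wn : has_dim (quotmod W) 'C(Q, 2).
Proof.
pose L (c : 'rV[k]_d) : quotmod W := quotmod_pi W (lift0 c).
have L_linear : linear L.
  by move=> a x y; rewrite /L lift0_linear quotmod_piD quotmod_piZ.
have L_inj : injective L.
  move=> x y /eqP; rewrite quotmod_eq => Wxy; apply/subr0_eq.
  apply: lift0_Wn_inj; rewrite addrC -scaleN1r lift0_linear scaleN1r addrC.
  exact: Wxy.
have L_surj x : exists c, L c == x.
  have [c Wc] := lift0_Wn_surj (repr x); exists c.
  by rewrite eq_sym -[x]quotmod_piK quotmod_eq.
(* [has_dim] asks for a map out of the quotient, so [L] is inverted by choice; linearity of the
   inverse follows from injectivity of [L]. *)
pose Linv x := xchoose (L_surj x).
have LinvK : cancel Linv L by move=> x; apply/eqP/(xchooseP (L_surj x)).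
have LK : cancel L Linv by move=> c; apply: L_inj; rewrite LinvK.
constructor; exists Linv; last by exists L.
by move=> a x y; apply: L_inj; rewrite L_linear !LinvK.
Qed.

End WnStructure.

Theorem corollary2p1 (k : finFieldType) (n : nat) (hn : (1 <= n)%N) :
  has_dim (quotmod (Wn k n)) 'C(#|k| ^ n, 2) /\ proper_tspace (Wn k n).
Proof.
have Q_gt1 : (1 < #|k| ^ n)%N.
  by rewrite -(expn0 #|k|) ltn_exp2l // finNzRing_gt1.
split; first exact: has_dim_Wn.
split; first exact: tspace_genP.
(* [X] has degree 1, a gap as soon as [Q > 1]. *)
exists (monom0 k 0); apply/negP => /(Wn_deg Q_gt1).
have -> : monom0 k 0 != 0 by rewrite -val_eqE /= expr1 polyX_eq0.
by rewrite /= size_polyXn /gap divn_small // modn_small // => /(_ isT).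
Qed.
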